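(* Let $N$ be a positive integer and let $A$ be a modular set modulo $N$. (i) $S(A)=A+N\cdot S(0)$. (ii) Let $\alpha\in\mathbb{N}$ with $\gcd(\alpha,N)=1$. Then $\alpha\cdot A+N\cdot S(0)$ is a modular Stanley sequence modulo $3^{\ell}\cdot N$ for some integer $\ell\ge 0$.
   Context: A set of integers is 3-free if it contains no three distinct terms in arithmetic progression. For a finite 3-free set $A=\{a_0<\cdots<a_k\}$ of nonnegative integers, the Stanley sequence $S(A)=(a_n)_{n\ge 0}$ is defined greedily: once $a_0<\cdots<a_n$ (with $n\ge k$) are defined, $a_{n+1}$ is the smallest integer greater than $a_n$ such that $\{a_0,\ldots,a_{n+1}\}$ is 3-free. $S(A)$ is also regarded as a set, and $S(0)$ means $S(\{0\})$. For a positive integer $N$ and $A\subseteq\{0,\ldots,N-1\}$: $A$ is 3-free modulo $N$ if there are no $x,y,z\in A$, not all equal, with $2y-z\equiv x\pmod N$; an integer $x$ is covered by $A$ modulo $N$ if there exist $y,z\in A$ with $z<y$ and $2y-z\equiv x\pmod N$. $A$ is a modular set modulo $N$ if $0\in A\subseteq\{0,\ldots,N-1\}$, $A$ is 3-free modulo $N$, and every $x\in\{0,\ldots,N-1\}\setminus A$ is covered by $A$ modulo $N$. A sequence (viewed as a set, listed in increasing order) is a modular Stanley sequence modulo $N$ if it equals $S(A)$ for some modular set $A$ modulo $N$. Notation: $X+Y=\{x+y\mid x\in X,\ y\in Y\}$ and $c\cdot X=\{cx\mid x\in X\}$. $\mathbb{N}$ denotes the positive integers. *)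

(* Defs.v *)
From mathcomp Require Import all_boot all_order all_algebra.
From mathcomp Require Import finmap.
From mathcomp Require Import all_classical.

Set Implicit Arguments.
Unset Strict Implicit.
Unset Printing Implicit Defensive.

Local Open Scope nat_scope.
Local Open Scope classical_set_scope.

Definition three_free (X : set nat) : Prop :=
  ~ exists x y z, [/\ X x, X y, X z, uniq [:: x; y; z] & x + z = 2 * y].

(* The default value 0 of [xget] is never used when [s] is increasing and
   3-free: 2 * last 0 s + 1 is always an admissible candidate. *)
Definition stanley_next (s : seq nat) : nat :=
  xget 0 [set x | [/\ last 0 s < x, three_free [set` rcons s x] &
    forall y, last 0 s < y -> three_free [set` rcons s y] -> x <= y]].

(* The list A = {a_0 < ... < a_k}, followed by [m] greedily chosen terms. *)
Fixpoint stanley_prefix (A : {fset nat}) (m : nat) : seq nat :=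
  if m is m'.+1 then
    let s := stanley_prefix A m' in rcons s (stanley_next s)
  else sort leq (enum_fset A).

(* a_n is read off a prefix which has #|A| + n > n terms (A is nonempty). *)
Definition stanley_seq (A : {fset nat}) (n : nat) : nat :=
  nth 0 (stanley_prefix A n) n.

Definition stanley (A : {fset nat}) : set nat := range (stanley_seq A).

Definition sumset (X Y : set nat) : set nat := [set x + y | x in X & y in Y].

Definition dilate (c : nat) (X : set nat) : set nat := [set c * x | x in X].

(* Congruences are stated in [int], since 2 * y - z may be negative. *)
Definition three_free_mod (N : nat) (A : {fset nat}) : Prop :=
  ~ exists x y z : nat, [/\ x \in A, y \in A, z \in A, ~ (x = y /\ y = z) &
    (2 * y%:Z - z%:Z = x%:Z %[mod N%:Z])%Z].

Definition covered_mod (N : nat) (A : {fset nat}) (x : int) : Prop :=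
  exists y z : nat, [/\ y \in A, z \in A, z < y &
    (2 * y%:Z - z%:Z = x %[mod N%:Z])%Z].

Definition modular_set (N : nat) (A : {fset nat}) : Prop :=
  [/\ 0 \in A,
      forall x : nat, x \in A -> x < N,
      three_free_mod N A &
      forall x : nat, x < N -> x \notin A -> covered_mod N A x%:Z].

(* A sequence is identified with the set of its terms. *)
Definition modular_stanley (N : nat) (X : set nat) : Prop :=
  exists2 A : {fset nat}, modular_set N A & X = stanley A.

(* Main.v *)
Require Import Defs.
From mathcomp Require Import all_boot all_order all_algebra.
From mathcomp Require Import finmap.
From mathcomp Require Import all_classical.
From mathcomp Require Import zify ring.

Import GRing.Theory.

(** A set [T] is the Stanley sequence of [A] as soon as it is 3-free, starts
with [A], and each later integer missing from [T] is the last term of a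
3-term progression whose other two terms lie in [T].  These conditions
([greedy_set]) leave no choice at any integer, so they determine [T]
([greedy_set_unique]), and the greedy algorithm fulfils them
([greedy_stanley]).  Every equality of Stanley sequences below is obtained by
checking them for a candidate set.

(i) The candidate is [T = A + N S(0)].  A progression in [T] reduces modulo [N]
to one in [A], hence its terms have the same [A]-part, and their [S(0)]-parts
form a progression in [S(0)].  Conversely, modularity writes any [n] as
[2b - c + N m] with [c <= b] in [A], and greediness of [S(0)] writes [m >= 0]
as [2t - u] with [u <= t] in [S(0)]; thus [n] is the last term of a progression
with terms [c + N u] and [b + N t], which are equal only if [n] is in [T].

(ii) The same two computations, done modulo [M N], show that
[alpha A + N P] is modular modulo [M N] when [A] is modular modulo [N], [P] is
modular modulo [M], [alpha] is prime to [N], and all these sums are less than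
[M N] ([modular_radix_sum]): multiplying by an inverse of [alpha] modulo [N]
reduces the [A]-part to the case [alpha = 1].  It is applied with [P] the set of
[l]-digit ternary numbers with digits 0 and 1, and [M = 3 ^ l].  The elements of
[P] stay below half of [M], which leaves room for [alpha A] once
[2 alpha < 3 ^ l].  Finally [S(0) = P + 3 ^ l S(0)] ([stanley0_split]), so (i)
for the new modular set gives back [alpha A + N S(0)]. *)

Set Implicit Arguments.
Unset Strict Implicit.
Unset Printing Implicit Defensive.

Local Open Scope fset_scope.
Local Open Scope classical_set_scope.
Local Open Scope nat_scope.

(** * Greedy sets *)

Definition ends_progression (T : set nat) (n : nat) : Prop :=
  exists y z, [/\ T y, T z, z < y & n + z = 2 * y].

(** The third clause says that [T] has no new element below the maximum of [A];
quantifying over the elements of [A] avoids naming this maximum. *)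
Definition greedy_set (A : {fset nat}) (T : set nat) : Prop :=
  [/\ three_free T,
      [set` A] `<=` T,
      forall n, T n -> n \notin A -> forall a, a \in A -> a < n &
      forall n, (forall a, a \in A -> a < n) -> ~ T n ->
        ends_progression T n].

Lemma three_free_ends (T : set nat) n :
  three_free T -> T n -> ~ ends_progression T n.
Proof.
move=> T3 Tn [y [z [Ty Tz zy e]]]; apply: T3; exists n, y, z; split => //.
by rewrite /= !inE; lia.
Qed.

(** At the first integer where two such sets differ, one contains it while in
the other, hence in both, it ends a progression. *)
Lemma greedy_set_unique A T T' : greedy_set A T -> greedy_set A T' -> T = T'.
Proof.
move=> gT gT'.
have half U V n : greedy_set A U -> greedy_set A V ->
    (forall m, m < n -> V m -> U m) -> U n -> V n.
  move=> [U3 _ Uhi _] [_ AV _ Vcov] VU Un.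
  have [/AV//|nA] := boolP (n \in A).
  apply: contrapT => /(Vcov _ (Uhi _ Un nA)) [y [z [Vy Vz zy e]]].
  by apply: (three_free_ends U3 Un); exists y, z; split => //; apply: VU => //; lia.
suff TT' n : T n <-> T' n by apply/seteqP; split => n /TT'.
elim/ltn_ind: n => n IH.
by split; apply: half => // m /IH -[].
Qed.

Lemma three_free_sub (T U : set nat) : T `<=` U -> three_free U -> three_free T.
Proof.
move=> TU U3 [x [y [z [Tx Ty Tz u e]]]].
by apply: U3; exists x, y, z; split => //; apply: TU.
Qed.

(** * The greedy construction *)

Lemma last_max (s : seq nat) x : sorted ltn s -> x \in s -> x <= last 0 s.
Proof.
case: s => // y s /= ps; rewrite inE => /predU1P[->|xs].
  elim: s y ps => //= z s IH y /andP[yz /IH]; exact/leq_trans/ltnW.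
elim: s y ps xs => //= z s IH y /andP[yz ps]; rewrite inE => /predU1P[->|/IH]; last exact.
elim: s z {yz IH} ps => //= w s IH z /andP[zw /IH]; exact/leq_trans/ltnW.
Qed.

(** The new term is the largest, so in a progression it can only be an end. *)
Lemma three_free_rcons (s : seq nat) n : sorted ltn s -> last 0 s < n ->
  three_free [set` s] ->
  three_free [set` rcons s n] <-> ~ ends_progression [set` s] n.
Proof.
move=> srt sn s3; split.
  move=> r3 [y [z [ys zs zy e]]].
  apply: (three_free_ends r3 (n := n)); first by rewrite /= mem_rcons mem_head.
  by exists y, z; split => //=; rewrite mem_rcons inE; apply/orP; right.
have ltn_s x : x \in s -> x < n.
  by move=> /(last_max srt)/leq_ltn_trans; apply.
move=> nend [x [y [z [/=]]]].
rewrite !mem_rcons !inE => /predU1P[->|xs] /predU1P[->|ys] /predU1P[->|zs] u e.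
- by lia.
- by lia.
- by lia.
- by case: nend; exists y, z; split => //; have := ltn_s _ ys; lia.
- by lia.
- by have := ltn_s _ xs; have := ltn_s _ zs; lia.
- by case: nend; exists y, x; split => //; have := ltn_s _ ys; lia.
- by apply: s3; exists x, y, z; split; rewrite //= !inE.
Qed.

(** The default value in [stanley_next] is never reached: any candidate beyond
twice the last term is too large to end a progression. *)
Lemma stanley_nextP (s : seq nat) : sorted ltn s -> three_free [set` s] ->
  [/\ last 0 s < stanley_next s, ~ ends_progression [set` s] (stanley_next s) &
    forall n, last 0 s < n < stanley_next s -> ends_progression [set` s] n].
Proof.
move=> srt s3.
pose ok x := `[< last 0 s < x /\ three_free [set` rcons s x] >].
have ex : exists x, ok x.
  exists (2 * last 0 s).+1; apply/asboolP; split; first lia.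
  apply/three_free_rcons => //; first lia.
  by move=> [y [z [/(last_max srt) ys _ _]]]; lia.
have : [set x | [/\ last 0 s < x, three_free [set` rcons s x] &
    forall y, last 0 s < y -> three_free [set` rcons s y] -> x <= y]]
    (stanley_next s).
  apply: (xgetPex 0); case: (ex_minnP ex) => x /asboolP[sx x3] xmin.
  by exists x; split => // y sy y3; apply/xmin/asboolP.
move=> [lt_s next3 next_min]; split => //; first exact/three_free_rcons.
move=> n /andP[sn n_next]; apply: contrapT => /three_free_rcons.
by move=> /(_ srt sn s3)/(next_min _ sn); lia.
Qed.

Section Prefixes.
Variable A : {fset nat}.
Hypotheses (A_free : three_free [set` A]) (A_nonempty : A != fset0).

Local Notation pre := (stanley_prefix A).

Lemma stanley_prefix_invariant m :
  sorted ltn (pre m) /\ three_free [set` pre m].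
Proof.
elim: m => [|m [srt s3]] /=.
  have mem_sortA : [set` sort leq A] = [set` A].
    by apply/seteqP; split => x /=; rewrite mem_sort.
  split; last by rewrite mem_sortA.
  rewrite ltn_sorted_uniq_leq sort_uniq fset_uniq /=.
  exact/sort_sorted/leq_total.
have [lt_s nend _] := stanley_nextP srt s3.
split; last exact/three_free_rcons.
case: (pre m) srt lt_s => [|x s] //= ps lt_s.
by rewrite rcons_path ps.
Qed.

Let next_prefix m := stanley_nextP (stanley_prefix_invariant m).1
  (stanley_prefix_invariant m).2.

Lemma size_stanley_prefix m : size (pre m) = #|` A| + m.
Proof.
by elim: m => [|m IH] /=; rewrite ?size_sort ?addn0 // size_rcons IH addnS.
Qed.

Lemma nth_stanley_prefix m i :
  i < size (pre m) -> nth 0 (pre m) i = stanley_seq A i.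
Proof.
have ext d k j : j < size (pre k) -> nth 0 (pre (d + k)) j = nth 0 (pre k) j.
  move=> jk; elim: d => //= d IH.
  rewrite nth_rcons ifT ?IH //.
  by move: jk; rewrite !size_stanley_prefix; lia.
have ii : i < size (pre i).
  by rewrite size_stanley_prefix; have := A_nonempty; rewrite -cardfs_gt0; lia.
rewrite /stanley_seq => im.
by rewrite -(ext i m i im) -(ext m i i ii) addnC.
Qed.

Lemma stanley_prefix_stanley n :
  stanley A n <-> exists m, n \in pre m.
Proof.
split => [[i _ <-]|[m nm]].
  exists i; rewrite /stanley_seq mem_nth // size_stanley_prefix.
  by have := A_nonempty; rewrite -cardfs_gt0; lia.
exists (index n (pre m)) => //.
by rewrite -(@nth_stanley_prefix m) ?index_mem ?nth_index.
Qed.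

Lemma stanley_prefix_sub m k : m <= k -> {subset pre m <= pre k}.
Proof.
move=> /subnK <- x; elim: (k - m) => //= d IH /IH xd.
by rewrite mem_rcons inE xd orbT.
Qed.

Lemma stanley_prefix_last_ge m : m <= last 0 (pre m).
Proof.
elim: m => //= m IH; rewrite last_rcons.
by have [lt_s _ _] := next_prefix m; apply: leq_ltn_trans lt_s.
Qed.

(** An integer outside the sequence and above [A] lies strictly between two
consecutive terms, so the greedy rule rejected it. *)
Lemma greedy_stanley : greedy_set A (stanley A).
Proof.
have A_pre a : a \in A -> a \in pre 0 by rewrite /= mem_sort.
split.
- move=> [x [y [z [/stanley_prefix_stanley[i xi] /stanley_prefix_stanley[j yj]
    /stanley_prefix_stanley[k zk] u e]]]].
  have [_] := stanley_prefix_invariant (i + j + k); apply.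
  exists x, y, z; split => //=.
  + by apply: stanley_prefix_sub xi; lia.
  + by apply: stanley_prefix_sub yj; lia.
  + by apply: stanley_prefix_sub zk; lia.
- by move=> a aA; apply/stanley_prefix_stanley; exists 0; apply: A_pre.
- move=> n /stanley_prefix_stanley[m nm] nA a aA.
  elim: m nm => [|m IH] /=; first by rewrite mem_sort (negPf nA).
  rewrite mem_rcons inE => /predU1P[->|//].
  have [lt_s _ _] := next_prefix m; apply: leq_ltn_trans lt_s.
  apply: last_max; first exact: (stanley_prefix_invariant m).1.
  exact: stanley_prefix_sub (A_pre _ aA).
- move=> n An nT.
  have cov m : n <= last 0 (pre m) -> ends_progression (stanley A) n.
    elim: m => [|m IH].
      have: last 0 (pre 0) \in pre 0.
        case E: (pre 0) => [|x s]; last exact: mem_last.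
        by have := size_stanley_prefix 0; have := A_nonempty;
          rewrite E -cardfs_gt0 /=; lia.
      by rewrite [X in _ \in X]/= mem_sort => /An; lia.
    rewrite /= last_rcons => n_next.
    have [/IH//|m_n] := leqP n (last 0 (pre m)).
    (* so [n] was skipped when passing from stage [m] to stage [m.+1] *)
    have n_neq : n <> stanley_next (pre m).
      move=> e; apply/nT/stanley_prefix_stanley; exists m.+1.
      by rewrite /= mem_rcons -e mem_head.
    have [_ _ /(_ n)] := next_prefix m.
    case=> [|y [z [ys zs zy e]]]; first by lia.
    by exists y, z; split => //; apply/stanley_prefix_stanley; exists m.
  exact: cov (stanley_prefix_last_ge n).
Qed.

End Prefixes.

Lemma stanley_eqP A T :
  A != fset0 -> greedy_set A T -> stanley A = T.
Proof.
move=> A0 gT; have [T3 AT _ _] := gT.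
exact: greedy_set_unique (greedy_stanley (three_free_sub AT T3) A0) gT.
Qed.

Lemma greedy_stanley0 : greedy_set [fset 0] (stanley [fset 0]).
Proof.
apply: greedy_stanley; last by apply/fset0Pn; exists 0; rewrite inE.
move=> [x [y [z [/=]]]].
by rewrite !inE => /eqP-> /eqP-> /eqP->.
Qed.

Lemma stanley0_0 : stanley [fset 0] 0.
Proof. by have [_ + _ _] := greedy_stanley0; apply; rewrite /= inE. Qed.

(** Allowing the constant progression [t = u = n] treats members and
non-members of [S(0)] alike. *)
Lemma stanley0_complete n : exists t u,
  [/\ stanley [fset 0] t, stanley [fset 0] u, u <= t & n + u = 2 * t].
Proof.
have [Sn|nS] := pselect (stanley [fset 0] n).
  by exists n, n; split => //; lia.
have [_ _ _ cov] := greedy_stanley0.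
case: (cov n) => // [a|t [u [St Su ut e]]].
  rewrite inE => /eqP ->; case: n nS => // nS; by case: nS; exact: stanley0_0.
by exists t, u; split => //; exact: ltnW.
Qed.

(** * Modular sets *)

Lemma eqmodzP (a b d : int) :
  (a = b %[mod d])%Z <-> exists k : int, (a = b + k * d)%R.
Proof.
split=> [/eqP|[k ->]]; last by rewrite addrC modzMDl.
by rewrite eqz_mod_dvd => /dvdzP[k e]; exists k; lia.
Qed.

Lemma three_free_modE N A x y z (k : int) : three_free_mod N A ->
  x \in A -> y \in A -> z \in A ->
  (2 * y%:Z - z%:Z = x%:Z + k * N%:Z)%R -> x = y /\ y = z.
Proof.
move=> A3 xA yA zA e; apply: contrapT => ne; apply: A3.
by exists x, y, z; split => //; apply/eqmodzP; exists k.
Qed.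

(** As in [stanley0_complete], members of [A] are written with [b = c]; [x] is
any integer because the proofs below need residues of negative numbers. *)
Lemma modular_complete N A (x : int) : 0 < N -> modular_set N A ->
  exists b c (k : int), [/\ b \in A, c \in A, c <= b &
    (2 * b%:Z - c%:Z = x + k * N%:Z)%R].
Proof.
move=> N0 [_ _ _ cov].
have r0 : (0 <= (x %% N%:Z)%Z)%R by rewrite modz_ge0; lia.
have rN : ((x %% N%:Z)%Z < N%:Z)%R by apply: ltz_pmod; lia.
have xE := divz_eq x N%:Z.
move: r0 rN xE; case: (x %% N%:Z)%Z => // r _ rN xE.
have [rA|rA] := boolP (r \in A).
  by exists r, r, (- (x %/ N%:Z)%Z)%R; split => //; lia.
have [|b [c [bA cA cb /eqmodzP[k e]]]] := cov r _ rA; first by lia.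
by exists b, c, (k - (x %/ N%:Z)%Z)%R; split => //; lia.
Qed.

Lemma modular_nonempty N A : modular_set N A -> A != fset0.
Proof. by case=> A0 _ _ _; apply/fset0Pn; exists 0. Qed.

(** The delicate point of the covering is that [2b - c], congruent to [n]
modulo [N], must not exceed [n], because only nonnegative multiples of [N] can
be added to it.  This holds because [b < n] and [b < N]. *)
Lemma stanley_modular N A : 0 < N -> modular_set N A ->
  stanley A = sumset [set` A] (dilate N (stanley [fset 0])).
Proof.
move=> N0 mA; have [A0 AN A3 _] := mA; have [S3 _ _ _] := greedy_stanley0.
apply: stanley_eqP; first exact: modular_nonempty mA.
split.
- move=> [x [y [z [[a aA [_ [s Ss <-] <-]] [b bA [_ [t St <-] <-]]
    [c cA [_ [u Su <-] <-]] uq e]]]].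
  have [|ab bc] := @three_free_modE N A a b c (s%:Z + u%:Z - 2 * t%:Z)%R A3 aA bA cA.
    by nia.
  subst b c; apply: S3; exists s, t, u; split => //; last by nia.
  by move: uq; rewrite /= !inE; nia.
- move=> a aA; exists a => //; exists 0; rewrite ?addn0 //.
  by exists 0; [exact: stanley0_0|exact: muln0].
- move=> n [a aA [_ [s Ss <-] <-]] nA c /AN cN.
  have : s != 0 by apply: contraNneq nA => ->; rewrite muln0 addn0.
  by nia.
- move=> n An nT.
  have [b [c [k [bA cA cb e]]]] := @modular_complete N A n N0 mA.
  have bn := An _ bA; have bN := AN _ bA.
  (* otherwise [n + N <= 2 * b - c <= 2 * b < n + N] *)
  have k0 : (k <= 0)%R by nia.
  have [t [u [St Su ut etu]]] := stanley0_complete `|k|%N.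
  have inT a s : a \in A -> stanley [fset 0] s ->
      sumset [set` A] (dilate N (stanley [fset 0])) (a + N * s).
    by move=> aA Ss; exists a => //; exists (N * s) => //; exists s.
  have eN : n + (c + N * u) = 2 * (b + N * t).
    have : (`|k|%N%:Z = - k)%R by lia.
    by nia.
  exists (b + N * t), (c + N * u); split => //; [exact: inT|exact: inT|].
  (* equal terms would make the progression constant, with [n] in the set *)
  rewrite ltn_neqAle leq_add ?leq_mul // andbT; apply/eqP => yz.
  by apply: nT; have -> : n = b + N * t by [lia]; exact: inT.
Qed.

Definition radix_sum alpha (A : {fset nat}) N (P : {fset nat}) : {fset nat} :=
  [fset alpha * a + N * p | a in A, p in P].

Lemma radix_sumP alpha A N P x :
  reflect (exists a p, [/\ a \in A, p \in P & x = alpha * a + N * p])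
          (x \in radix_sum alpha A N P).
Proof.
apply: (iffP idP) => [/imfset2P[a aA [p pP ->]]|[a [p [aA pP ->]]]].
  by exists a, p.
by apply/imfset2P; exists a => //; exists p.
Qed.

(** Coprimality serves twice: it cancels [alpha] in a progression modulo [N],
and its Bezout relation inverts [alpha] to solve [alpha (2b - c) = x]
modulo [N]. *)
Lemma modular_radix_sum alpha A N P M : 0 < N -> 0 < M -> coprime alpha N ->
  modular_set N A -> modular_set M P ->
  (forall a p : nat, a \in A -> p \in P -> alpha * a + N * p < M * N) ->
  modular_set (M * N) (radix_sum alpha A N P).
Proof.
move=> N0 M0 co mA mP bound.
have [A0 _ A3 _] := mA; have [P0 _ P3 _] := mP.
have ltB (x : nat) : x \in radix_sum alpha A N P -> x < M * N.
  by move=> /radix_sumP[a [p [aA pP ->]]]; exact: bound.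
split => //.
- by apply/radix_sumP; exists 0, 0; rewrite !muln0.
- move=> [_ [_ [_ [/radix_sumP[a [s [aA sP ->]]] /radix_sumP[b [t [bA tP ->]]]
    /radix_sumP[c [u [cA uP ->]]] ne /eqmodzP[k e]]]]].
  have dv : (N%:Z %| (alpha%:Z * (2 * b%:Z - c%:Z - a%:Z))%R)%Z.
    apply/dvdzP; exists (k * M%:Z + s%:Z + u%:Z - 2 * t%:Z)%R.
    by move: e; rewrite !PoszD !PoszM; lia.
  move: dv; rewrite Gauss_dvdzr; last by rewrite coprimezE coprime_sym.
  move=> /dvdzP[j ej].
  have [|ab bc] := @three_free_modE N A a b c j A3 aA bA cA; first by lia.
  subst b c.
  have [|st tu] := @three_free_modE M P s t u k P3 sP tP uP.
    have : (N%:Z * (2 * t%:Z - u%:Z) = N%:Z * (s%:Z + k * M%:Z))%R.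
      by move: e; rewrite !PoszD !PoszM; lia.
    by apply: mulfI; lia.
  by subst t u; apply: ne.
- move=> x xlt xB.
  have /coprimezP[[be ga] /= bez] : coprimez alpha N by rewrite coprimezE.
  (* [be] inverts [alpha] modulo [N], and the second equation absorbs the
     multiple of [N] left over by the first one *)
  have [b [c [k [bA cA cb e]]]] := modular_complete (be * x%:Z)%R N0 mA.
  have [t [u [i [tP uP ut f]]]] :=
    modular_complete (ga * x%:Z - alpha%:Z * k)%R M0 mP.
  have eq_x : (2 * (alpha * b + N * t)%N%:Z - (alpha * c + N * u)%N%:Z
      = x%:Z + i * (M * N)%N%:Z)%R.
    have -> : (2 * (alpha * b + N * t)%N%:Z - (alpha * c + N * u)%N%:Z
      = alpha%:Z * (2 * b%:Z - c%:Z) + N%:Z * (2 * t%:Z - u%:Z))%R.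
      by rewrite !PoszD !PoszM; ring.
    rewrite e f PoszM.
    transitivity ((be * alpha%:Z + ga * N%:Z) * x%:Z + i * (M%:Z * N%:Z))%R.
      by ring.
    by rewrite bez mul1r.
  have yB : alpha * b + N * t \in radix_sum alpha A N P.
    by apply/radix_sumP; exists b, t.
  exists (alpha * b + N * t), (alpha * c + N * u); split => //.
  + by apply/radix_sumP; exists c, u.
  (* if the two terms coincide then [x] is congruent to their common value, and
     both are reduced modulo [M * N] *)
  + rewrite ltn_neqAle leq_add ?leq_mul // andbT; apply/eqP => yz.
    move/negP: xB; apply; have yN := ltB _ yB.
    suff -> : x = alpha * b + N * t by [].
    rewrite yz in eq_x yN *.
    have : i = 0%R by nia.
    by move=> i0; rewrite i0 mul0r in eq_x; lia.
  + by apply/eqmodzP; exists i.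
Qed.

Lemma sumset_radix_sum alpha A N P M (T : set nat) :
  sumset [set` radix_sum alpha A N P] (dilate (M * N) T) =
  sumset (dilate alpha [set` A]) (dilate N (sumset [set` P] (dilate M T))).
Proof.
apply/seteqP; split => [_ [_ /= /radix_sumP[a [p [aA pP ->]]] [_ [t Tt <-] <-]]|].
  exists (alpha * a); first by exists a.
  exists (N * (p + M * t)); last by nia.
  by exists (p + M * t) => //; exists p => //; exists (M * t) => //; exists t.
move=> _ [_ [a aA <-] [_ [_ [p pP [_ [t Tt <-] <-]] <-] <-]].
exists (alpha * a + N * p); first by apply/radix_sumP; exists a, p.
by exists (M * N * t); [exists t|nia].
Qed.

Lemma dilate1 T : dilate 1 T = T.
Proof.
apply/seteqP; split => [_ [x Tx <-]|x Tx]; first by rewrite mul1n.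
by exists x => //; rewrite mul1n.
Qed.

(** * Ternary digits *)

Fixpoint binary_digits3 l : {fset nat} :=
  if l is l'.+1 then radix_sum 1 [fset 0; 1] 3 (binary_digits3 l') else [fset 0].

Lemma modular01 : modular_set 3 [fset 0; 1].
Proof.
split.
- by rewrite !inE.
- by move=> x; rewrite !inE; lia.
- move=> [x [y [z [xA yA zA ne /eqmodzP[k e]]]]].
  by move: xA yA zA; rewrite !inE; lia.
- move=> x x3; rewrite !inE => xA; exists 1, 0; split; rewrite ?inE //.
  by apply/eqmodzP; exists 0%R; lia.
Qed.

(** The set on the right is [S({0, 1})] by the modular set [{0, 1}] modulo 3,
and 1 is the term that the greedy rule adds to [{0}]. *)
Lemma stanley0_rec :
  stanley [fset 0] = sumset [set` [fset 0; 1]] (dilate 3 (stanley [fset 0])).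
Proof.
rewrite -(stanley_modular _ modular01) //.
have /greedy_stanley : three_free [set` [fset 0; 1]].
  move=> [x [y [z [/=]]]]; rewrite !inE; lia.
move=> /(_ (modular_nonempty modular01)) [S3 AS hi cov].
apply: stanley_eqP; first by apply/fset0Pn; exists 0; rewrite inE.
split => //.
- by move=> x /=; rewrite inE => /eqP ->; apply: AS; rewrite /= !inE.
- by move=> n _; rewrite inE => n0 a; rewrite inE => /eqP ->; lia.
- move=> n n0 nS; apply: cov => // a; rewrite !inE => /orP[]/eqP -> .
    by apply: n0; rewrite inE.
  have := n0 0; rewrite inE eqxx => /(_ isT).
  case: n nS {n0} => [|[|n]] // nS _.
  by case: nS; apply: AS; rewrite /= !inE.
Qed.

Lemma modular_binary_digits3 l : modular_set (3 ^ l) (binary_digits3 l).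
Proof.
elim: l => [|l IH] /=.
  split.
  - by rewrite inE.
  - by move=> x; rewrite inE => /eqP ->.
  - by move=> [x [y [z []]]]; rewrite !inE => /eqP-> /eqP-> /eqP->; case.
  - by move=> x; rewrite expn0 inE; lia.
rewrite expnSr; apply: modular_radix_sum => //.
- by rewrite expn_gt0.
- exact: modular01.
- have [_ ub _ _] := IH => a p; rewrite !inE => a01 /ub; nia.
Qed.

Lemma binary_digits3_lt l p : p \in binary_digits3 l -> 2 * p < 3 ^ l.
Proof.
elim: l p => [|l IH] p /=; first by rewrite inE => /eqP ->.
move=> /radix_sumP[a [q [aA /IH qlt ->]]]; move: aA; rewrite !inE expnS; lia.
Qed.

Lemma stanley0_split l : stanley [fset 0] =
  sumset [set` binary_digits3 l] (dilate (3 ^ l) (stanley [fset 0])).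
Proof.
elim: l => [|l IH] /=.
  rewrite expn0 dilate1; apply/seteqP; split => [x Sx|_ [z + [x Sx <-]]].
    by exists 0; rewrite /= ?inE //; exists x.
  by rewrite /= inE => /eqP ->.
by rewrite expnSr sumset_radix_sum dilate1 -IH -stanley0_rec.
Qed.

Theorem theorem2p4 (N : nat) (A : {fset nat})
  (hN : 0 < N) (hA : modular_set N A) :
  stanley A = sumset [set` A] (dilate N (stanley [fset 0])) /\
  (forall alpha : nat, 0 < alpha -> coprime alpha N ->
     exists l : nat,
       modular_stanley (3 ^ l * N)
         (sumset (dilate alpha [set` A]) (dilate N (stanley [fset 0])))).
Proof.
split; first exact: stanley_modular.
move=> alpha alpha0 co; exists (2 * alpha).
(* any [l] with [2 * alpha < 3 ^ l] would do *)
have M0 : 0 < 3 ^ (2 * alpha) by rewrite expn_gt0.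
have mB : modular_set (3 ^ (2 * alpha) * N)
    (radix_sum alpha A N (binary_digits3 (2 * alpha))).
  apply: modular_radix_sum => //; first exact: modular_binary_digits3.
  have [_ AN _ _] := hA => a p /AN aN /binary_digits3_lt pM.
  have aM : 2 * alpha < 3 ^ (2 * alpha) by exact: ltn_expl.
  by nia.
exists (radix_sum alpha A N (binary_digits3 (2 * alpha))) => //.
by rewrite (stanley_modular _ mB) ?muln_gt0 ?M0 // sumset_radix_sum -stanley0_split.
Qed.
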